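(* Let $G$ be a simple graph with $n$ vertices. Then $G$ can be embedded in $\mathbb{R}^d$ as a two-distance set $S$ with $d=n-\mu(G)-1$ and $B(S)=\theta(G)$. In particular, if $$\theta(G)+\mu(G)>n,$$ then $S$ is a counterexample to Borsuk's conjecture.
   Context: For a bounded set $S\subset\mathbb{R}^d$, $B(S)$ denotes the smallest number of subsets with diameters smaller than the diameter of $S$ that cover $S$. Borsuk's conjecture asserts that $B(S)\le d+1$ for every bounded $S\subset\mathbb{R}^d$; a counterexample is a bounded set $S\subset\mathbb{R}^d$ with $B(S)>d+1$. A set $S$ in Euclidean space $\mathbb{R}^d$ is called a two-distance set if there are two distances $a$ and $b$ such that the distances between pairs of distinct points of $S$ are either $a$ or $b$. A graph is embedded as a two-distance set when its vertices are mapped to distinct points so that adjacent vertices are at the smaller distance, normalized to $a=1$, and distinct non-adjacent vertices are at the larger distance $b>1$. Let $G=(V,E)$ be a simple graph with $n=|V|$ and vertices labelled $1,\dots,n$. For $i\neq j$ set $x_{ij}=1$ if $\{i,j\}\in E$ and $x_{ij}=t$ otherwise, where $t$ is a variable. Let $A_G(t)$ be the symmetric $(n+1)\times(n+1)$ matrix $$A_G(t)=\begin{bmatrix}0&1&1&\cdots&1\\1&0&x_{12}&\cdots&x_{1n}\\1&x_{21}&0&\cdots&x_{2n}\\\vdots&\vdots&\vdots&\ddots&\vdots\\1&x_{n1}&x_{n2}&\cdots&0\end{bmatrix},\qquad C_G(t)=\det A_G(t).$$ If the equation $C_G(t)=0$ has a solution $t>1$, then $\mu(G)$ denotes the multiplicity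 of the smallest zero $t>1$ of $C_G(t)$. If $C_G(t)$ has no zeros $t>1$, then $\mu(G)=0$. $\theta(G)$ denotes the clique covering number of $G$, i.e. the smallest number of cliques that together include every vertex of $G$.
   Formalization: The equality B(S)=θ(G) is claimed only for non-complete G (for complete G, θ(G)=1, but no set is covered by one subset of smaller diameter, so it fails), and G has at least one vertex; the embedding, its dimension and the counterexample claim hold for all such G. *)

(* Defs.v *)
From mathcomp Require Import all_boot all_order all_algebra.
From mathcomp Require Import all_classical all_reals.

Set Implicit Arguments.
Unset Strict Implicit.
Unset Printing Implicit Defensive.

Import Order.TTheory GRing.Theory Num.Theory.

Local Open Scope classical_set_scope.
Local Open Scope ring_scope.

(* The library norm on 'rV[R]_d is the sup norm, hence an explicit
   Euclidean distance. *)
Definition edist (R : realType) (d : nat) (x y : 'rV[R]_d) : R :=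
  Num.sqrt (\sum_(i < d) (x 0 i - y 0 i) ^+ 2).

Definition ebounded (R : realType) (d : nat) (S : set 'rV[R]_d) : Prop :=
  exists M : R, forall x y, S x -> S y -> edist x y <= M.

(* Only meaningful on bounded sets: [sup] is 0 on sets without supremum, in
   particular the empty set has diameter 0. *)
Definition diam (R : realType) (d : nat) (S : set 'rV[R]_d) : R :=
  sup [set r | exists x y, [/\ S x, S y & r = edist x y]].

Definition borsuk_cover (R : realType) (d : nat) (S : set 'rV[R]_d) (k : nat)
    : Prop :=
  exists C : 'I_k -> set 'rV[R]_d,
    (forall i, C i `<=` S /\ diam (C i) < diam S) /\
    S `<=` \bigcup_(i in setT) C i.

(* "B(S) is defined and equal to k".  A relation rather than a function,
   because some sets (e.g. a single point) have no cover by sets of smaller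
   diameter. *)
Definition is_borsuk_number (R : realType) (d : nat) (S : set 'rV[R]_d)
    (k : nat) : Prop :=
  borsuk_cover S k /\ forall m : nat, borsuk_cover S m -> (k <= m)%N.

Definition borsuk_counterexample (R : realType) (d : nat) (S : set 'rV[R]_d)
    : Prop :=
  ebounded S /\ exists k : nat, is_borsuk_number S k /\ (d + 1 < k)%N.

Definition two_distance_set (R : realType) (d : nat) (S : set 'rV[R]_d)
    : Prop :=
  exists a b : R, forall x y, S x -> S y -> x <> y ->
    edist x y = a \/ edist x y = b.

Definition two_distance_embedding (R : realType) (V : finType) (e : rel V)
    (d : nat) (f : V -> 'rV[R]_d) : Prop :=
  injective f /\
  exists b : R, 1 < b /\
    forall u v : V, u != v -> edist (f u) (f v) = if e u v then 1 else b.

(* Row and column 0 are the border; index [lift ord0 i] stands for the i-th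
   vertex in the enumeration of V; t is the polynomial variable 'X. *)
Definition graph_matrix (R : realType) (V : finType) (e : rel V)
    : 'M[{poly R}]_(#|V|.+1) :=
  \matrix_(i, j)
    match unlift ord0 i, unlift ord0 j with
    | None, None => 0
    | Some i', Some j' =>
        if i' == j' then 0
        else if e (enum_val i') (enum_val j') then 1 else 'X
    | _, _ => 1
    end.

Definition graph_poly (R : realType) (V : finType) (e : rel V) : {poly R} :=
  \det (graph_matrix R e).

Definition is_smallest_zero_gt1 (R : realType) (p : {poly R}) (t : R) : Prop :=
  [/\ 1 < t, root p t & forall s : R, 1 < s -> root p s -> t <= s].

(* [xget 0] picks the smallest zero; for nonempty V the default 0 is never
   used, since graph_poly is then a nonzero polynomial. *)
Definition graph_mu (R : realType) (V : finType) (e : rel V) : nat :=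
  let p := graph_poly R e in
  if `[< exists t : R, 1 < t /\ root p t >]
  then mup (xget 0 [set t | is_smallest_zero_gt1 p t]) p
  else 0%N.

Definition is_clique (V : finType) (e : rel V) (K : {set V}) : bool :=
  [forall u in K, forall v in K, (u != v) ==> e u v].

Definition clique_coverable (V : finType) (e : rel V) (k : nat) : bool :=
  [exists P : {set {set V}},
    [&& finset.cover P == [set: V]%SET, [forall K in P, is_clique e K] & #|P| == k]].

Lemma clique_coverable_ex (V : finType) (e : rel V) :
  exists k : nat, clique_coverable e k.
Proof.
pose P := [set [set x]%SET | x in [set: V]%SET]%SET.
exists #|P|; apply/existsP; exists P; rewrite eqxx andbT; apply/andP; split.
  apply/eqP/setP => x; rewrite inE; apply/bigcupP; exists [set x]%SET.
    by apply/imsetP; exists x.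
  by rewrite inE.
apply/forall_inP => _ /imsetP[x _ ->].
apply/forall_inP => u; rewrite inE => /eqP ->.
by apply/forall_inP => v; rewrite inE => /eqP ->; rewrite eqxx.
Qed.

Definition clique_cover_number (V : finType) (e : rel V) : nat :=
  ex_minn (clique_coverable_ex e).

(* A complete graph on at least two vertices embeds as a regular simplex of
   diameter 1 (not b), whose Borsuk number is #|V| although one clique covers
   all vertices. *)
Definition complete_graph (V : finType) (e : rel V) : Prop :=
  forall u v : V, u != v -> e u v.

(* Main.v *)
Require Import Defs.
From mathcomp Require Import all_boot all_order all_algebra.
From mathcomp Require Import all_classical all_reals.
From mathcomp Require Import zify ring lra.

(** Fix a vertex 0 and ask for points with squared distances x_ij, equal to 1
  on edges and to t on non-edges. They exist in dimension d exactly when the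
  Gram matrix of the other m = n - 1 vertices with respect to 0,
  G_ij = (x_0i + x_0j - x_ij) / 2, has the form Z Z^T with Z of width d. Row
  operations on the bordered matrix use up the border and the row of vertex 0
  and leave -2 G, so the graph polynomial is a nonzero constant times
  det G(t) ([det_graph_sqdist]). Moreover G(t) = A + (t - 1) B is affine in t,
  and A = G(1), the Gram matrix of a regular simplex, is positive definite.

  As t grows from 1, G(t) can stop being positive definite only at a zero of
  its determinant, so at the smallest zero t > 1 it is positive semidefinite
  ([possemidef_pencil]); if there is no such zero, any t > 1 serves. At this t,
  the rank r of G(t) is the dimension of the embedding, and m - r is the
  multiplicity of the zero ([mup_pencil_poly]). Indeed, in a basis adapted to
  the kernel, G(t + s) is block diag(1, 0) + s W, whose determinant is s^(m - r)
  times a function with value det W_22 at s = 0; and W_22, which represents B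
  on the kernel of G(t), is negative definite because on that kernel
  (t - 1) B = - A. Hence d = m - mu = n - mu - 1.

  In the embedded set all distances are at most b = sqrt t, and b is attained
  unless the graph is complete. So a subset has diameter smaller than b exactly
  when its points are pairwise adjacent, and covers by sets of smaller diameter
  are clique covers ([borsuk_number_clique_cover]). A complete graph has
  theta <= 1 and mu <= n - 1, hence never satisfies theta + mu > n. *)

Local Open Scope classical_set_scope.

Set Implicit Arguments.
Unset Strict Implicit.
Unset Printing Implicit Defensive.

(** * Positive semidefinite matrices *)

Section SymmetricMatrices.
Import Order.TTheory GRing.Theory Num.Theory.
Local Open Scope ring_scope.
Variable R : realType.

Definition qform m (S : 'M[R]_m) (v : 'rV_m) : R := (v *m S *m v^T) 0 0.

Definition posdef m (S : 'M[R]_m) := forall v : 'rV_m, v != 0 -> 0 < qform S v.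

Definition possemidef m (S : 'M[R]_m) := forall v : 'rV_m, 0 <= qform S v.

Lemma posdefW m (S : 'M[R]_m) : posdef S -> possemidef S.
Proof.
move=> S_pd v; have [->|v0] := eqVneq v 0; last exact: ltW (S_pd _ v0).
by rewrite /qform !mul0mx mxE.
Qed.

Lemma qformD m (S T : 'M[R]_m) v : qform (S + T) v = qform S v + qform T v.
Proof. by rewrite /qform mulmxDr mulmxDl mxE. Qed.

Lemma qformZ m a (S : 'M[R]_m) v : qform (a *: S) v = a * qform S v.
Proof. by rewrite /qform -scalemxAr -scalemxAl mxE. Qed.

Lemma qform_congr m r (L : 'M[R]_(m, r)) (S : 'M_r) v :
  qform (L *m S *m L^T) v = qform S (v *m L).
Proof. by rewrite /qform trmx_mul !mulmxA. Qed.

Lemma qformE m (S : 'M[R]_m) v :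
  qform S v = \sum_i \sum_j S i j * v 0 i * v 0 j.
Proof.
rewrite /qform mxE exchange_big /=; apply: eq_bigr => j _.
by rewrite !mxE mulr_suml; apply: eq_bigr => i _; rewrite [v 0 i * _]mulrC.
Qed.

Lemma qform1E m (v : 'rV[R]_m) : qform 1%:M v = \sum_i v 0 i ^+ 2.
Proof. by rewrite /qform mulmx1 mxE; apply: eq_bigr => i _; rewrite mxE. Qed.

Lemma posdef1 m : posdef (1%:M : 'M[R]_m).
Proof.
move=> v v0; rewrite qform1E lt_def sumr_ge0 ?andbT => [|i _]; last exact: sqr_ge0.
apply: contra v0 => /eqP s0; apply/eqP/rowP => i; rewrite mxE.
apply/eqP; rewrite -sqrf_eq0; apply/eqP.
by apply: (psumr_eq0P _ s0) => // j _; apply: sqr_ge0.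
Qed.

Lemma posdef_gram m r (X : 'M[R]_(m, r)) : row_free X -> posdef (X *m X^T).
Proof.
move=> Xf v v0; rewrite -{1}(mulmx1 X) qform_congr; apply: posdef1.
by rewrite mulmx_free_eq0.
Qed.

Lemma posdef_det m (S : 'M[R]_m) : posdef S -> \det S != 0.
Proof.
move=> S_pd; apply/det0P => -[v /S_pd + vS].
by rewrite /qform vS mul0mx mxE ltxx.
Qed.

(** The value of the form at (x, y) is a quadratic polynomial in x. When a = 0
  it is affine in x and bounded below, which forces b = 0. Otherwise its minimum,
  at x = - (b y^T) / a, is the Schur complement evaluated at y; as 0^-1 = 0, the
  same formula for x serves both cases. *)
Lemma possemidef_schur m (a : R) (b : 'rV_m) (T : 'M_m) :
  possemidef (block_mx a%:M b b^T T : 'M_(1 + m)) ->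
  [/\ 0 <= a, (a = 0 -> b = 0) & possemidef (T - a^-1 *: (b^T *m b))].
Proof.
set S := block_mx _ _ _ _ => S_psd.
have qE x (y : 'rV_m) : qform S (row_mx x%:M y) =
    a * x ^+ 2 + 2 * x * (b *m y^T) 0 0 + qform T y.
  have -> : qform S (row_mx x%:M y) =
      (x ^+ 2 *: a%:M + x *: (y *m b^T) + x *: (b *m y^T) + y *m T *m y^T) 0 0.
    rewrite /qform mul_row_block tr_row_mx mul_row_col !mulmxDl.
    rewrite tr_scalar_mx -scalar_mxM !mul_scalar_mx !mul_mx_scalar -scalemxAl.
    by rewrite !scale_scalar_mx mulrAC -expr2 !addrA.
  have -> : y *m b^T = b *m y^T.
    by rewrite [RHS]mx11_scalar -tr_scalar_mx -mx11_scalar trmx_mul trmxK.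
  rewrite /qform; move: (b *m _) (_ *m T *m _) => p q.
  by rewrite !mxE mulr1n; ring.
have a_ge0 : 0 <= a.
  by have := S_psd (row_mx 1%:M 0); rewrite qE /qform trmx0 !mulmx0 !mxE; lra.
have b0 : a = 0 -> b = 0.
  move=> a0; apply/rowP => j; rewrite mxE; apply/eqP/negPn/negP => bj.
  (* With this x the form takes the value - 1 at (x, delta_j). *)
  pose x := - (T j j + 1) / (2 * b 0 j).
  have := S_psd (row_mx x%:M (delta_mx 0 j)); rewrite qE a0 /qform.
  rewrite trmx_delta -colE -rowE -colE !mxE.
  have -> : 2 * x * b 0 j = - (T j j + 1) by rewrite /x; field.
  by lra.
split=> // y; pose w := (b *m y^T) 0 0.
have := S_psd (row_mx (- w / a)%:M y); rewrite qE -/w qformD => /le_trans; apply.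
rewrite addrC lerD2l -scaleNr qformZ.
have -> : qform (b^T *m b) y = w ^+ 2.
  by rewrite /qform /w mulmxA -mulmxA mxE big_ord1 -{1}[y]trmxK -trmx_mul mxE expr2.
have [->|an0] := eqVneq a 0.
  by rewrite invr0 !(mulr0, mul0r, oppr0, addr0).
by rewrite le_eqVlt; apply/orP; left; apply/eqP; field.
Qed.

(** Induction on the size through the Schur complement. A zero pivot makes its
  whole row and column vanish, and then yields a zero column of X. *)
Lemma cholesky m (S : 'M[R]_m) : S^T = S -> possemidef S ->
  exists X : 'M_m, S = X *m X^T.
Proof.
elim: m S => [|m IHm]; first by exists 0; apply/matrixP => -[].
rewrite -[m.+1]/(1 + m)%N => S Ssym S_psd.
pose a := ulsubmx S 0 0; pose b := ursubmx S; pose T := drsubmx S.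
have SE : S = block_mx a%:M b b^T T.
  by rewrite /a -mx11_scalar /b /T trmx_ursub Ssym submxK.
have Tsym : T^T = T by rewrite /T trmx_drsub Ssym.
move: S_psd; rewrite SE => /possemidef_schur[a_ge0 b0 T'psd].
have [|X XE] := IHm _ _ T'psd.
  by rewrite linearB /= linearZ /= trmx_mul trmxK Tsym.
exists (block_mx (Num.sqrt a)%:M 0 ((Num.sqrt a)^-1 *: b^T) X).
rewrite tr_block_mx mulmx_block !trmx0 tr_scalar_mx !mulmx0 !mul0mx !addr0 -XE.
rewrite -scalar_mxM -expr2 sqr_sqrtr // linearZ /= trmxK.
rewrite mul_scalar_mx -scalemxAr -!scalemxAl mul_mx_scalar.
have [a0|an0] := eqVneq a 0.
  by rewrite (b0 a0) a0 trmx0 !scaler0 !mul0mx !scaler0 add0r subr0.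
have sn0 : Num.sqrt a != 0 by rewrite sqrtr_eq0 -ltNge lt_def an0.
rewrite !scalerA divff // mulVf // !scale1r -invfM -expr2 sqr_sqrtr //.
by rewrite addrC subrK.
Qed.

(** Absorbing D: the upper left block of D D^T is positive definite, so it is
  Y Y^T with Y invertible, and Y can be moved into the outer factor. *)
Lemma gram_pid r k (C D : 'M[R]_(r + k)) (X := C *m pid_mx r *m D) :
  C \in unitmx -> D \in unitmx ->
  exists2 L, L \in unitmx & X *m X^T = L *m pid_mx r *m L^T.
Proof.
move=> Cu Du; pose W := D *m D^T.
have W_pd : posdef W by apply: posdef_gram; rewrite row_free_unit.
have Wsym : W^T = W by rewrite trmx_mul trmxK.
have W1_pd : posdef (ulsubmx W).
  move=> v v0; have -> : qform (ulsubmx W) v = qform W (row_mx v 0).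
    rewrite /qform -[in RHS](submxK W) mul_row_block tr_row_mx mul_row_col.
    by rewrite trmx0 !(mul0mx, mulmx0) !addr0.
  by apply: W_pd; apply: contra v0; rewrite row_mx_eq0 => /andP[].
have [|Y YE] := cholesky _ (posdefW W1_pd); first by rewrite trmx_ulsub Wsym.
have Yu : Y \in unitmx.
  have := posdef_det W1_pd; rewrite YE det_mulmx mulf_eq0 negb_or => /andP[Y0 _].
  by rewrite unitmxE unitfE.
exists (C *m block_mx Y 0 0 1%:M).
  rewrite unitmx_mul Cu unitmxE det_ublock det1 mulr1 unitfE.
  by rewrite unitmxE unitfE in Yu.
rewrite !trmx_mul tr_pid_mx !mulmxA; congr (_ *m _).
rewrite -!mulmxA; congr (_ *m _).
rewrite [D *m _]mulmxA -/W -(submxK W) tr_block_mx !trmx0 trmx1.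
rewrite !pid_mx_block !mulmx_block.
by rewrite !(mul0mx, mulmx0, mul1mx, mulmx1, addr0) YE.
Qed.

(** Sylvester's law of inertia for semidefinite forms: the normal form
  diag(1, .., 1, 0, .., 0) is reached by congruence. *)
Lemma possemidef_pid m (S : 'M[R]_m) : S^T = S -> possemidef S ->
  exists r (L : 'M_m), [/\ (r <= m)%N, L \in unitmx & S = L *m pid_mx r *m L^T].
Proof.
move=> Ssym /(cholesky Ssym)[X ->] {Ssym}; exists (\rank X).
have rm := rank_leq_row X; move: (mulmx_ebase X).
move: (\rank X) rm (col_ebase_unit X) (row_ebase_unit X) => r rm.
move: (col_ebase X) (row_ebase X) => C D Cu Du XE.
have [k mE] : exists k, m = (r + k)%N by exists (m - r)%N; rewrite subnKC.
move: mE => mE; subst m.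
by have [L Lu LE] := gram_pid Cu Du; exists L; rewrite -XE.
Qed.

(** The factor X - t can be taken out of each of the last k rows; what remains
  has the value det D * det W_22 at t. *)
Lemma mup_det_block r k (t : R) (D : 'M[R]_r) (W : 'M[R]_(r + k)) :
  \det D != 0 -> \det (drsubmx W) != 0 ->
  mup t (\det (map_mx polyC (block_mx D 0 0 0) + ('X - t%:P) *: map_mx polyC W))
    = k.
Proof.
move=> D0 W0; set M := _ + _; pose s := 'X - t%:P.
pose Q := block_mx (map_mx polyC D + s *: map_mx polyC (ulsubmx W))
  (s *: map_mx polyC (ursubmx W))
  (map_mx polyC (dlsubmx W)) (map_mx polyC (drsubmx W)).
have ME : M = block_mx 1%:M 0 0 s%:M *m Q.
  rewrite /M /Q -{1}(submxK W) !map_block_mx !map_mx0 scale_block_mx.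
  rewrite add_block_mx !add0r mulmx_block !(mul0mx, mul1mx, addr0, add0r).
  by rewrite !mul_scalar_mx.
have Qt : ~~ root (\det Q) t.
  have tE : root (\det Q) t = (\det (map_mx (horner_eval t) Q) == 0).
    by rewrite det_map_mx.
  have cK m n (N : 'M[R]_(m, n)) : map_mx (horner_eval t) (map_mx polyC N) = N.
    by apply/matrixP => i j; rewrite !mxE /horner_eval hornerC.
  have s0 m n (N : 'M[{poly R}]_(m, n)) : map_mx (horner_eval t) (s *: N) = 0.
    by apply/matrixP => i j; rewrite !mxE /horner_eval !hornerE subrr mul0r.
  rewrite tE map_block_mx map_mxD !s0 !cK addr0 det_lblock mulf_eq0.
  by rewrite negb_or D0.
rewrite ME det_mulmx det_ublock det1 mul1r det_scalar mupMl //.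
by rewrite mup_XsubCX eqxx.
Qed.
End SymmetricMatrices.

(** * Affine families of symmetric matrices *)

Section Pencil.
Import Order.TTheory GRing.Theory Num.Theory.
Local Open Scope ring_scope.
Variable R : realType.

Definition pencil m (A B : 'M[R]_m) (t : R) : 'M_m := A + (t - 1) *: B.

Definition pencil_poly m (A B : 'M[R]_m) : {poly R} :=
  \det (map_mx polyC A + ('X - 1) *: map_mx polyC B).

Lemma horner_pencil_poly m (A B : 'M[R]_m) t :
  (pencil_poly A B).[t] = \det (pencil A B t).
Proof.
rewrite -[LHS]/(horner_eval t _) -det_map_mx; congr (\det _).
by apply/matrixP => i j; rewrite !mxE /= /horner_eval !hornerE.
Qed.

Lemma qform_pencil m (A B : 'M[R]_m) t v :
  qform (pencil A B t) v = qform A v + (t - 1) * qform B v.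
Proof. by rewrite qformD qformZ. Qed.

Lemma pencil_sym m (A B : 'M[R]_m) t :
  A^T = A -> B^T = B -> (pencil A B t)^T = pencil A B t.
Proof. by move=> As Bs; rewrite linearD /= linearZ /= As Bs. Qed.

Lemma qform_bound m (W : 'M[R]_m) v :
  `|qform W v| <= (\sum_i \sum_j `|W i j|) * qform 1%:M v.
Proof.
have vi i : `|v 0 i| ^+ 2 <= qform 1%:M v.
  rewrite qform1E (bigD1 i) //= real_normK ?num_real // lerDl sumr_ge0 // => j _.
  exact: sqr_ge0.
rewrite qformE mulr_suml (le_trans (ler_norm_sum _ _ _)) // ler_sum // => i _.
rewrite mulr_suml (le_trans (ler_norm_sum _ _ _)) // ler_sum // => j _.
rewrite !normrM -mulrA ler_wpM2l //.
by have := vi i; have := vi j; have := sqr_ge0 (`|v 0 i| - `|v 0 j|); nra.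
Qed.

(** After the congruence by X the claim is about 1 + s W, and
  [qform_bound] bounds the form of W by K times the square norm, so any
  s <= 1 / (K + 1) works. *)
Lemma possemidef_open m (S B : 'M[R]_m) :
  S^T = S -> possemidef S -> \det S != 0 ->
  exists2 eps, 0 < eps & forall s, 0 <= s <= eps -> possemidef (S + s *: B).
Proof.
move=> Ssym /(cholesky Ssym)[X ->] {Ssym}.
rewrite det_mulmx mulf_eq0 negb_or => /andP[X0 _].
have Xu : X \in unitmx by rewrite unitmxE unitfE.
pose W := invmx X *m B *m (invmx X)^T; pose K := \sum_i \sum_j `|W i j|.
have K_ge0 : 0 <= K by do 2![apply: sumr_ge0 => ? _].
exists (K + 1)^-1 => [|s /andP[s0 sK] v]; first by rewrite invr_gt0; lra.
have -> : X *m X^T + s *: B = X *m (1%:M + s *: W) *m X^T.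
  rewrite mulmxDr mulmxDl mulmx1 -scalemxAr -scalemxAl; congr (_ + s *: _).
  by rewrite /W !mulmxA mulmxV // mul1mx -mulmxA -trmx_mul mulmxV // trmx1 mulmx1.
rewrite qform_congr; move: (v *m X) => u; rewrite qformD qformZ.
have := qform_bound W u; rewrite -/K ler_norml => /andP[lo _].
have u0 : 0 <= qform 1%:M u by apply: posdefW; exact: posdef1.
have sK1 : s * K <= 1.
  rewrite (le_trans (ler_wpM2r K_ge0 sK)) // mulrC ler_pdivrMr ?mul1r; lra.
have := ler_wpM2l s0 lo; have := ler_wpM2r u0 sK1; lra.
Qed.

(** Let tau be the supremum of the parameters up to t0 where the pencil is
  semidefinite. Semidefiniteness is a closed condition, so it holds at tau; if
  tau < t0, the determinant does not vanish there and
  [possemidef_open] lets tau be exceeded. *)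
Lemma possemidef_pencil m (A B : 'M[R]_m) t0 :
  A^T = A -> B^T = B -> posdef A -> 1 <= t0 ->
  (forall t, 1 <= t -> t < t0 -> \det (pencil A B t) != 0) ->
  possemidef (pencil A B t0).
Proof.
move=> As Bs A_pd t0_ge1 ndet; have sym t := pencil_sym t As Bs; clear As Bs.
pose E := [set t | 1 <= t <= t0 /\ possemidef (pencil A B t)].
have E1 : E 1.
  split; first by rewrite lexx.
  by rewrite /pencil subrr scale0r addr0; exact: posdefW.
have Esup : has_sup E by split; [exists 1 | exists t0 => t [/andP[]]].
pose tau := sup E.
have tau_ge1 : 1 <= tau by apply: sup_upper_bound.
have tau_le : tau <= t0 by apply: ge_sup; [exists 1 | move=> t [/andP[]]].
have tau_psd : possemidef (pencil A B tau).
  move=> v; rewrite qform_pencil leNgt; apply/negP => neg.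
  have A0 : 0 <= qform A v by apply: posdefW.
  have B0 : qform B v < 0.
    by rewrite ltNge; apply/negP => B0; nra.
  (* The right-hand side is the zero of the affine function
     t |-> qform (pencil A B t) v, an upper bound of E because B is negative
     on v. *)
  suff : tau <= 1 - qform A v / qform B v.
    have : qform A v / qform B v * qform B v = qform A v by rewrite mulfVK ?lt_eqF.
    by move: (_ / _) => c ? ?; nra.
  apply: ge_sup; first by exists 1.
  move=> t [_ /(_ v)]; rewrite qform_pencil => q0.
  rewrite -lerBlDl -lerN2 opprK opprB ler_ndivrMr //; lra.
have [->|ne] := eqVneq t0 tau; first exact: tau_psd.
have lt : tau < t0 by rewrite lt_def ne.
have [eps eps0 epsP] :=
  possemidef_open B (sym tau) tau_psd (ndet _ tau_ge1 lt).
pose s := Num.min eps (t0 - tau).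
have s0 : 0 < s by rewrite lt_min eps0 subr_gt0.
have sE : s <= eps by rewrite ge_min lexx.
have st : s <= t0 - tau by rewrite ge_min lexx orbT.
suff : tau + s <= tau by lra.
apply: sup_upper_bound => //; split; first by apply/andP; split; lra.
have -> : pencil A B (tau + s) = pencil A B tau + s *: B.
  by rewrite /pencil -[RHS]addrA -scalerDl; congr (_ + _ *: _); ring.
by apply: epsP; rewrite sE ltW.
Qed.

(** In the coordinates where the pencil at t is [pid_mx r], the lower right
  block of B is the form of B on the kernel of the pencil. There
  qform A = - (t - 1) qform B, so the block is negative definite, in particular
  invertible, and the multiplicity is the dimension of the kernel. This replaces
  the simultaneous diagonalization of A and B. *)
Lemma mup_pencil_poly m (A B : 'M[R]_m) t :
  A^T = A -> B^T = B -> posdef A -> 1 < t -> possemidef (pencil A B t) ->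
  exists r (Z : 'M_(m, r)),
    pencil A B t = Z *m Z^T /\ (r + mup t (pencil_poly A B) = m)%N.
Proof.
move=> As Bs A_pd t1 t_psd; have sym := pencil_sym t As Bs; clear As Bs.
have [r [L [rm Lu LE]]] := possemidef_pid sym t_psd.
exists r, (L *m pid_mx r); split.
  by rewrite trmx_mul tr_pid_mx mulmxA -[L *m _ *m _]mulmxA pid_mx_id // LE.
have [k mE] : exists k, m = (r + k)%N by exists (m - r)%N; rewrite subnKC.
subst m; congr (_ + _)%N.
pose N := invmx L; pose W := N *m B *m N^T.
have NL : N *m L = 1%:M by rewrite mulVmx.
have NP : N *m pencil A B t *m N^T = pid_mx r.
  by rewrite LE !mulmxA NL mul1mx -mulmxA -trmx_mul NL trmx1 mulmx1.
have W22 : \det (drsubmx W) != 0.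
  suff : posdef (- drsubmx W).
    move/posdef_det; rewrite -scaleN1r detZ; apply: contraNneq => ->.
    by rewrite mulr0.
  move=> y y0; pose u := row_mx 0 y *m N.
  have u0 : u != 0.
    rewrite mulmx_free_eq0 ?row_free_unit ?unitmx_inv //.
    by apply: contra y0; rewrite row_mx_eq0 => /andP[].
  have : qform (pencil A B t) u = 0.
    rewrite /u -qform_congr NP pid_mx_block /qform mul_row_block.
    by rewrite !(mul0mx, mulmx0, addr0) row_mx0 mul0mx mxE.
  have -> : qform (- drsubmx W) y = - qform B u.
    rewrite /u -qform_congr -/W -scaleN1r qformZ mulN1r /qform -{2}(submxK W).
    rewrite mul_row_block tr_row_mx mul_row_col trmx0 !mul0mx mulmx0.
    by rewrite !add0r.
  rewrite qform_pencil; have := A_pd _ u0; nra.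
pose p := \det (map_mx polyC (block_mx 1%:M 0 0 0 : 'M_(r + k)) +
  ('X - t%:P) *: map_mx polyC W).
have pE : p = (\det N ^+ 2)%:P * pencil_poly A B.
  have -> : (\det N ^+ 2)%:P = \det (map_mx polyC N) * \det (map_mx polyC N)^T.
    by rewrite det_tr det_map_mx /= -rmorphM expr2.
  rewrite mulrAC -!det_mulmx /p; congr (\det _).
  rewrite -pid_mx_block -NP /W !map_mxM /= -!map_trmx.
  rewrite scalemxAl scalemxAr -mulmxDl -mulmxDr; congr (_ *m _ *m _).
  rewrite /pencil map_mxD map_mxZ /= -[LHS]addrA -scalerDl; congr (_ + _ *: _).
  by rewrite rmorphB rmorph1; ring.
have N0 : \det N ^+ 2 != 0.
  by rewrite expf_neq0 // -unitfE -unitmxE unitmx_inv.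
rewrite -[LHS](@mupMr _ _ (\det N ^+ 2)%:P) ?rootC // -pE.
by apply: mup_det_block => //; rewrite det1 oner_neq0.
Qed.

(** The number [graph_mu], for an arbitrary polynomial in place of the graph
  polynomial. *)
Definition poly_mu (p : {poly R}) : nat :=
  if `[< exists t : R, 1 < t /\ root p t >]
  then mup (xget 0 [set t | is_smallest_zero_gt1 p t]) p
  else 0%N.

Lemma poly_muZ c p : c != 0 -> poly_mu (c *: p) = poly_mu p.
Proof.
move=> c0; rewrite /poly_mu.
have rE t : root (c *: p) t = root p t by rewrite rootZ.
have -> : (exists t, 1 < t /\ root (c *: p) t) =
    (exists t, 1 < t /\ root p t).
  by apply: eq_exists => t; rewrite rE.
have -> : is_smallest_zero_gt1 (c *: p) = is_smallest_zero_gt1 p.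
  apply/funext => t; apply/propext.
  split=> -[t1]; [rewrite rE | rewrite -rE] => tr min; split=> // s s1.
    by rewrite -rE; apply: min.
  by rewrite rE; apply: min.
by rewrite -mul_polyC mupMr // rootC.
Qed.

(** Induction on the degree, dividing out one zero t: the smallest zero is t or
  the smallest zero of the quotient. *)
Lemma ex_smallest_zero_gt1 (p : {poly R}) : p != 0 ->
  (exists t : R, 1 < t /\ root p t) -> exists t, is_smallest_zero_gt1 p t.
Proof.
elim: {p}(size p) {-2}p (leqnn (size p)) => [|n IHn] p.
  by rewrite leqn0 size_poly_eq0 => ->.
move=> sp p0 [t [t1]] /[dup] tr /factor_theorem[q pE].
have q0 : q != 0 by apply: contraNneq p0 => q0; rewrite pE q0 mul0r.
have rE s : root p s = root q s || (s == t) by rewrite pE rootM root_XsubC.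
have [qr|qnr] := pselect (exists s, 1 < s /\ root q s); last first.
  exists t; split=> // s s1; rewrite rE => /orP[sq|/eqP-> //].
  by case: qnr; exists s.
have [|s [s1 sr smin]] := IHn q _ q0 qr.
  by move: sp; rewrite pE size_Mmonic ?monicXsubC // size_XsubC addn2.
exists (Num.min s t); split; first by rewrite lt_min s1.
  by rewrite rE minEle; case: ifP; rewrite ?sr ?eqxx ?orbT.
move=> x x1; rewrite rE => /orP[xq|/eqP->]; rewrite ge_min ?lexx ?orbT //.
by rewrite smin.
Qed.

(** The choice of the parameter: the smallest zero of the determinant beyond 1
  if there is one, and 2 otherwise. In both cases [poly_mu] is the multiplicity
  of the chosen parameter as a zero, and no zero precedes it. *)
Lemma pencil_mu m (A B : 'M[R]_m) :
  A^T = A -> B^T = B -> posdef A ->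
  exists t d (Z : 'M_(m, d)), [/\ 1 < t, pencil A B t = Z *m Z^T &
    (d + poly_mu (pencil_poly A B) = m)%N].
Proof.
move=> As Bs A_pd; pose p := pencil_poly A B.
have p1 : ~~ root p 1.
  rewrite rootE horner_pencil_poly /pencil subrr scale0r addr0.
  exact: posdef_det.
have p0 : p != 0 by apply: contraNneq p1 => ->; rewrite root0.
suff [t [t1 mu_t nroot]] : exists t, [/\ 1 < t, poly_mu p = mup t p &
    forall s, 1 < s -> s < t -> ~~ root p s].
  have t_psd : possemidef (pencil A B t).
    apply: possemidef_pencil => // [|s s1 st]; first exact: ltW.
    rewrite -horner_pencil_poly -rootE.
    by move: s1; rewrite le_eqVlt => /orP[/eqP<- //|s1]; apply: nroot.
  have [d [Z [ZE dE]]] := mup_pencil_poly As Bs A_pd t1 t_psd.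
  by exists t, d, Z; rewrite mu_t.
rewrite /poly_mu; case: asboolP => [ex|nex]; last first.
  have nroot s : 1 < s -> ~~ root p s.
    by move=> s1; apply/negP => sr; apply: nex; exists s.
  have t1 : 1 < 2 :> R by lra.
  (* Without a zero beyond 1 every parameter beyond 1 is admissible. *)
  by exists 2; split=> //; [rewrite mupNroot ?nroot | move=> s s1 _; apply: nroot].
have [t tmin] := ex_smallest_zero_gt1 p0 ex.
have := xgetI 0 tmin; set t0 := xget _ _ => -[t01 _ min]; exists t0; split=> //.
by move=> s s1; apply: contraTN => sr; rewrite -leNgt min.
Qed.
End Pencil.

(** * From the bordered determinant to the Gram matrix *)

Section CayleyMenger.
Import Order.TTheory GRing.Theory Num.Theory.
Local Open Scope ring_scope.

Lemma det_schur (K : comNzRingType) p m (H : 'M[K]_p) U (C : 'M_(m, p)) D :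
  \det (block_mx H U (C *m H) D) = \det H * \det (D - C *m U).
Proof.
have -> : block_mx H U (C *m H) D =
    block_mx 1%:M 0 C 1%:M *m block_mx H U 0 (D - C *m U).
  by rewrite mulmx_block !(mul1mx, mul0mx, mulmx0, addr0) addrC subrK.
by rewrite det_mulmx det_lblock det_ublock !det1 !mul1r.
Qed.

Definition bordered (K : nzRingType) n (x : 'I_n -> 'I_n -> K) : 'M[K]_n.+1 :=
  \matrix_(i, j)
    match unlift ord0 i, unlift ord0 j with
    | None, None => 0
    | Some i', Some j' => x i' j'
    | _, _ => 1
    end.

(** Schur complement of the upper left 2 x 2 block, formed by the border and
  index 0. As x 0 0 = 0 this block is the exchange matrix: it has determinant -1,
  and multiplying by it swaps the two columns of C. *)
Lemma det_bordered (K : comNzRingType) m (x : 'I_m.+1 -> 'I_m.+1 -> K) :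
  x 0 0 = 0 ->
  \det (bordered x) = - \det (\matrix_(i < m, j < m)
    (x (lift 0 i) (lift 0 j) - x (lift 0 i) 0 - x 0 (lift 0 j))).
Proof.
move=> x00; pose M : 'M_(2 + m) := bordered x.
have l0 : lshift m (0 : 'I_2) = 0 :> 'I_(2 + m) by apply: val_inj.
have l1 : lshift m (1 : 'I_2) = lift 0 (0 : 'I_m.+1) :> 'I_(2 + m) by apply: val_inj.
have r2 i : rshift 2 i = lift 0 (lift 0 i : 'I_m.+1) :> 'I_(2 + m) by apply: val_inj.
have o1 : lift 0 (0 : 'I_1) = 1 :> 'I_2 by apply: val_inj.
pose C : 'M[K]_(m, 2) := \matrix_(i, k) if k == 0 then x (lift 0 i) 0 else 1.
have ord2 (i : 'I_2) : i = 0 \/ i = 1.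
  by case: i => [[|[|//]] lti]; [left | right]; apply: val_inj.
have ulE : ulsubmx M = \matrix_(i, j) (i != j)%:R.
  apply/matrixP => i j; rewrite !mxE.
  by case: (ord2 i) (ord2 j) => -> [] ->; rewrite ?l0 ?l1 ?liftK ?unlift_none.
have dlE : dlsubmx M = C *m ulsubmx M.
  apply/matrixP => i j; rewrite ulE !mxE !big_ord_recl big_ord0 o1 !mxE addr0 r2.
  by case: (ord2 j) => ->; rewrite ?l0 ?l1 !liftK ?unlift_none /=
    ?(mulr0, mulr1, addr0, add0r).
have detU : \det (ulsubmx M) = -1.
  rewrite ulE (expand_det_row _ 0) !big_ord_recl big_ord0 o1 !mxE /cofactor.
  by rewrite !det_mx11 !mxE /=; ring.
have -> : \det (bordered x) =
    \det (ulsubmx M) * \det (drsubmx M - C *m ursubmx M).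
  by rewrite -det_schur -dlE submxK.
rewrite detU mulN1r.
congr (- \det _); apply/matrixP => i j.
rewrite !mxE !big_ord_recl big_ord0 o1 !mxE addr0 !r2 l0 l1.
by rewrite !liftK !unlift_none /= mulr1 mul1r opprD addrA.
Qed.

Definition graph_sqdist (K : nzRingType) n (a : rel 'I_n) (y : K) i j : K :=
  if i == j then 0 else if a i j then 1 else y.

Variable R : realType.

(** The law of cosines: the inner products of the vectors joining point 0 to
  points i and j, in terms of the squared distances x. *)
Definition gram (K : fieldType) m (x : 'I_m.+1 -> 'I_m.+1 -> K) : 'M[K]_m :=
  \matrix_(i, j) (2^-1 *
    (x 0 (lift 0 i) + x 0 (lift 0 j) - x (lift 0 i) (lift 0 j))).

(** Point 0 goes to the origin, the others to the rows of Z. *)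
Lemma gram_realize m d (x : 'I_m.+1 -> 'I_m.+1 -> R) (Z : 'M[R]_(m, d)) :
  (forall i, x i i = 0) -> (forall i j, x i j = x j i) -> gram x = Z *m Z^T ->
  exists f : 'I_m.+1 -> 'rV[R]_d,
    forall i j, \sum_k (f i 0 k - f j 0 k) ^+ 2 = x i j.
Proof.
move=> x0 xC GE.
pose f i := if unlift 0 i is Some i' then row i' Z else 0; exists f.
have ip i j : \sum_k f i 0 k * f j 0 k = 2^-1 * (x 0 i + x 0 j - x i j).
  rewrite /f; case: unliftP => [i'|] ->; last first.
    rewrite big1 ?x0 => [|k _]; last by rewrite mxE mul0r.
    by rewrite add0r subrr mulr0.
  case: unliftP => [j'|] ->; last first.
    rewrite big1 ?x0 => [|k _]; last by rewrite [X in _ * X]mxE mulr0.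
    by rewrite addr0 [x 0 _]xC subrr mulr0.
  have /matrixP/(_ i' j') := GE; rewrite !mxE => ->.
  by apply: eq_bigr => k _; rewrite !mxE.
move=> i j.
have -> : \sum_k (f i 0 k - f j 0 k) ^+ 2 = \sum_k f i 0 k * f i 0 k
    - 2 * (\sum_k f i 0 k * f j 0 k) + \sum_k f j 0 k * f j 0 k.
  by rewrite mulr_sumr -sumrB -big_split; apply: eq_bigr => k _ /=; ring.
by rewrite !ip !x0; field.
Qed.

(** The Gram matrix of the regular simplex is half of the identity plus half of
  the all-ones matrix. *)
Lemma gram_simplex_posdef m (x : 'I_m.+1 -> 'I_m.+1 -> R) :
  (forall i j, x i j = (i != j)%:R) -> posdef (gram x).
Proof.
move=> xE v v0; pose u : 'cV[R]_m := const_mx 1.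
have -> : gram x = 2^-1 *: (1%:M + u *m 1%:M *m u^T).
  apply/matrixP => i j; rewrite mulmx1 !mxE big_ord1 !mxE !xE.
  rewrite (inj_eq lift_inj) /= mulr1.
  by case: eqP => _ /=; congr (_ * _); ring.
rewrite qformZ qformD qform_congr mulr_gt0 ?invr_gt0 ?ltr0n //.
by apply: ltr_wpDr; [apply: posdefW; exact: posdef1 | exact: posdef1].
Qed.

Lemma gram_sym (K : fieldType) m (x : 'I_m.+1 -> 'I_m.+1 -> K) :
  (forall i j, x i j = x j i) -> (gram x)^T = gram x.
Proof.
move=> xC; apply/matrixP => i j; rewrite !mxE.
by rewrite [x (lift 0 j) _]xC [x 0 (lift 0 j) + _]addrC.
Qed.

(** The coefficient of y - 1 in [graph_sqdist a y]. *)
Definition nonedge (K : nzRingType) n (a : rel 'I_n) i j : K :=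
  ((i != j) && ~~ a i j)%:R.

Lemma graph_sqdistE (K : nzRingType) n (a : rel 'I_n) (y : K) i j :
  graph_sqdist a y i j = (i != j)%:R + (y - 1) * nonedge K a i j.
Proof.
rewrite /graph_sqdist /nonedge; case: eqP => _ /=; first by rewrite mulr0 addr0.
by case: (a i j); rewrite /= ?mulr0 ?addr0 // mulr1 addrC subrK.
Qed.

Lemma graph_sqdist_sym (K : nzRingType) n (a : rel 'I_n) (y : K) i j :
  symmetric a -> graph_sqdist a y i j = graph_sqdist a y j i.
Proof. by move=> aC; rewrite /graph_sqdist eq_sym aC. Qed.

(** The Schur complement of [det_bordered] is - 2 times the Gram matrix, which is
  affine in the unknown because the squared distances are. *)
Lemma det_graph_sqdist m (a : rel 'I_m.+1) : symmetric a ->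
  \det (bordered (graph_sqdist a 'X)) =
    - (-2) ^+ m *:
      pencil_poly (gram (graph_sqdist a (1 : R))) (gram (nonedge R a)).
Proof.
move=> aC; rewrite det_bordered; last by rewrite /graph_sqdist eqxx.
rewrite scaleNr -mul_polyC rmorphXn /= -detZ; congr (- \det _).
apply/matrixP => i j; rewrite !mxE [graph_sqdist a 'X _ 0]graph_sqdist_sym //.
have h2 : (-2)%:P * (2^-1)%:P = -1 :> {poly R}.
  by rewrite -polyCM mulNr divff ?pnatr_eq0 // polyCN.
have nE k l : (nonedge R a k l)%:P = nonedge _ a k l by rewrite /nonedge rmorph_nat.
move: h2; rewrite !polyCM; move: (-2)%:P (2^-1)%:P => c h ch.
rewrite !graph_sqdistE !(polyCM, polyCD, polyCN, nE, rmorph_nat) subrr.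
rewrite !mul0r !addr0.
rewrite -[in RHS]mulrCA -mulrDr mulrA ch; ring.
Qed.

Lemma gram_embedding n (a : rel 'I_n) : symmetric a -> (0 < n)%N ->
  exists d (f : 'I_n -> 'rV[R]_d) t,
    [/\ (d + poly_mu (\det (bordered (graph_sqdist a ('X : {poly R}))))
           + 1 = n)%N,
        1 < t &
      forall i j, \sum_k (f i 0 k - f j 0 k) ^+ 2 = graph_sqdist a t i j].
Proof.
case: n a => // m a aC _.
pose A := gram (graph_sqdist a (1 : R)); pose B := gram (nonedge R a).
have A_pd : posdef A.
  by apply: gram_simplex_posdef => i j; rewrite graph_sqdistE subrr mul0r addr0.
have As : A^T = A by apply: gram_sym => i j; apply: graph_sqdist_sym.
have Bs : B^T = B by apply: gram_sym => i j; rewrite /nonedge eq_sym aC.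
have [t [d [Z [t1 ZE dE]]]] := pencil_mu As Bs A_pd.
have GE : gram (graph_sqdist a t) = Z *m Z^T.
  rewrite -ZE; apply/matrixP => i j; rewrite !mxE !graph_sqdistE subrr; ring.
have [||f fE] := gram_realize _ _ GE.
- by move=> i; rewrite /graph_sqdist eqxx.
- by move=> i j; apply: graph_sqdist_sym.
exists d, f, t; split=> //; rewrite det_graph_sqdist // poly_muZ ?dE ?addn1 //.
by rewrite oppr_eq0 expf_neq0 // oppr_eq0 pnatr_eq0.
Qed.

Lemma edistxx d (x : 'rV[R]_d) : edist x x = 0.
Proof. by rewrite /edist big1 ?sqrtr0 // => i _; rewrite subrr expr0n. Qed.

Lemma graph_embedding (V : finType) (e : rel V) :
  symmetric e -> (0 < #|V|)%N ->
  exists (d : nat) (f : V -> 'rV[R]_d),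
    (d + graph_mu R e + 1 = #|V|)%N /\ two_distance_embedding e f.
Proof.
move=> e_sym V0; pose a (i j : 'I_#|V|) := e (enum_val i) (enum_val j).
have a_sym : symmetric a by move=> i j; apply: e_sym.
have [d [g [t [dE t1 gE]]]] := gram_embedding a_sym V0.
exists d, (g \o enum_rank); split; first exact: dE.
have s1 : 1 < Num.sqrt t by rewrite -[ltLHS]sqrtr1 ltr_sqrt // (lt_trans ltr01).
have gd u v : u != v ->
    edist (g (enum_rank u)) (g (enum_rank v)) = if e u v then 1 else Num.sqrt t.
  move=> uv; rewrite /edist gE /graph_sqdist (inj_eq enum_rank_inj) (negbTE uv).
  by rewrite /a !enum_rankK; case: ifP => _ //; rewrite sqrtr1.
split; last by exists (Num.sqrt t).
move=> u v /= guv; apply/eqP; apply: contraT => uv.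
have := gd _ _ uv; rewrite guv edistxx; case: ifP => _ /eqP;
  first by rewrite eq_sym oner_eq0.
by rewrite lt_eqF // (lt_trans _ s1).
Qed.

End CayleyMenger.

(** * Covers by sets of smaller diameter *)

Section BorsukPartitions.
Import Order.TTheory GRing.Theory Num.Theory.
Local Open Scope ring_scope.
Variables (R : realType) (V : finType) (e : rel V).
Variables (d : nat) (f : V -> 'rV[R]_d) (b : R).
Hypothesis b1 : 1 < b.
Hypothesis fE : forall u v, u != v -> edist (f u) (f v) = if e u v then 1 else b.

Lemma edist_le u v : edist (f u) (f v) <= b.
Proof.
have [->|uv] := eqVneq u v; first by rewrite edistxx ltW // (lt_trans ltr01).
by rewrite fE //; case: ifP => _; rewrite ?lexx // ltW.
Qed.

Lemma edist_lt u v : (edist (f u) (f v) < b) = (u == v) || e u v.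
Proof.
have [->|uv] := eqVneq u v; first by rewrite edistxx (lt_trans ltr01 b1).
by rewrite fE //=; case: ifP => _; rewrite ?ltxx.
Qed.

(** The distances within S are bounded, so [diam S] is a genuine supremum. *)
Lemma edist_diam (S : set 'rV[R]_d) u v :
  S `<=` range f -> S (f u) -> S (f v) -> edist (f u) (f v) <= diam S.
Proof.
move=> Sf Su Sv; apply: sup_upper_bound; last by exists (f u), (f v).
split; first by exists (edist (f u) (f v)), (f u), (f v).
by exists b => _ [x [y [/Sf[x' _ <-] /Sf[y' _ <-] ->]]]; apply: edist_le.
Qed.

Lemma diam_range : ~ complete_graph e -> diam (range f) = b.
Proof.
move=> /existsNP[u /existsNP[v /not_implyP[uv /negP nuv]]].
apply/eqP; rewrite eq_le; apply/andP; split.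
  apply: ge_sup; first by exists (edist (f u) (f v)), (f u), (f v); split.
  by move=> _ [_ [_ [[x _ <-] [y _ <-] ->]]]; apply: edist_le.
have := @edist_diam (range f) u v; rewrite fE // (negbTE nuv); apply=> //.
Qed.

(** The bound also covers the empty clique, whose image has diameter 0. *)
Lemma diam_clique (K : {set V}) : is_clique e K -> diam (f @` [set` K]) <= 1.
Proof.
move=> /forall_inP clK; rewrite /diam; set E := [set r | _].
have [->|E0] := eqVneq E set0; first by rewrite sup0.
apply: ge_sup; first exact/set0P.
move=> _ [_ [_ [[u uK <-] [v vK <-] ->]]].
have [->|uv] := eqVneq u v; first by rewrite edistxx.
by have /forall_inP/(_ v vK) := clK u uK; rewrite uv fE //= => ->.
Qed.

(** The preimage of a set of diameter smaller than b is a clique. *)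
Lemma clique_cover_number_le_borsuk_cover k : ~ complete_graph e ->
  borsuk_cover (range f) k -> (clique_cover_number e <= k)%N.
Proof.
move=> ncomp [C [Cd Cc]].
pose K i : {set V} := [set v | `[< C i (f v) >]]%SET.
pose P : {set {set V}} := [set K i | i : 'I_k]%SET.
have Pcov : clique_coverable e #|P|.
  apply/existsP; exists P; rewrite eqxx andbT; apply/andP; split.
    apply/eqP/setP => v; rewrite inE; apply/bigcupP.
    have [|i _ Cv] := Cc (f v); first by exists v.
    by exists (K i); [apply: imset_f | rewrite inE; apply/asboolP].
  apply/forall_inP => _ /imsetP[i _ ->].
  apply/forall_inP => u; rewrite inE => /asboolP Cu.
  apply/forall_inP => v; rewrite inE => /asboolP Cv.
  apply/implyP => uv; have [Ci Cdi] := Cd i.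
  have := le_lt_trans (edist_diam Ci Cu Cv) Cdi.
  by rewrite diam_range // edist_lt (negbTE uv).
rewrite /clique_cover_number; case: ex_minnP => n _ /(_ _ Pcov) /leq_trans; apply.
by rewrite -[leqRHS]card_ord leq_imset_card.
Qed.

Lemma clique_borsuk_cover : ~ complete_graph e ->
  borsuk_cover (range f) (clique_cover_number e).
Proof.
move=> ncomp; rewrite /clique_cover_number; case: ex_minnP => n.
move=> /existsP[P /and3P[/eqP Pcov /forall_inP Pcl /eqP <-]] _.
exists (fun i : 'I_#|P| => f @` [set` (enum_val i : {set V})]); split.
  move=> i; split; first by move=> _ [v _ <-]; exists v.
  rewrite diam_range //; apply: le_lt_trans b1; apply: diam_clique.
  by apply: Pcl; apply: enum_valP.
move=> _ [v _ <-]; have : v \in finset.cover P by rewrite Pcov inE.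
case/bigcupP => K KP vK; exists (enum_rank_in KP K) => //.
by exists v => //=; rewrite enum_rankK_in.
Qed.

Lemma borsuk_number_clique_cover : ~ complete_graph e ->
  is_borsuk_number (range f) (clique_cover_number e).
Proof.
move=> ncomp; split=> [|k]; first exact: clique_borsuk_cover.
exact: clique_cover_number_le_borsuk_cover.
Qed.

Lemma ebounded_range : ebounded (range f).
Proof. by exists b => _ _ [u _ <-] [v _ <-]; apply: edist_le. Qed.

Lemma two_distance_range : two_distance_set (range f).
Proof.
exists 1, b => _ _ [u _ <-] [v _ <-] fuv; rewrite fE.
  by case: ifP => _; [left | right].
by apply: contra_notN fuv => /eqP ->.
Qed.
End BorsukPartitions.

Lemma clique_cover_number_complete (V : finType) (e : rel V) :
  complete_graph e -> (clique_cover_number e <= 1)%N.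
Proof.
move=> comp; rewrite /clique_cover_number; case: ex_minnP => n _; apply.
apply/existsP; exists [set [set: V]%SET]%SET; rewrite cards1 eqxx andbT.
rewrite /finset.cover big_set1 eqxx /=; apply/forall_inP => K.
rewrite inE => /eqP ->; apply/forall_inP => u _; apply/forall_inP => v _.
by apply/implyP; apply: comp.
Qed.

Unset Implicit Arguments.

Theorem theorem1 (R : realType) (V : finType) (e : rel V) (n : nat)
    (e_sym : symmetric e) (e_irr : irreflexive e)
    (n_def : n = #|V|) (n_gt0 : (0 < n)%N) :
  exists (d : nat) (f : V -> 'rV[R]_d),
    [/\ (d + graph_mu R e + 1 = n)%N,
        two_distance_embedding e f /\ two_distance_set (range f),
        ~ complete_graph e ->
          is_borsuk_number (range f) (clique_cover_number e)
      & (n < clique_cover_number e + graph_mu R e)%N ->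
          borsuk_counterexample (range f)].
Proof.
subst n; have [d [f [dE emb]]] := graph_embedding R e_sym n_gt0.
have [f_inj [b [b1 fE]]] := emb; exists d, f.
split=> // [|ncomp|large].
- by split=> //; apply: two_distance_range fE.
- exact: borsuk_number_clique_cover b1 fE ncomp.
have ncomp : ~ complete_graph e.
  by move=> /clique_cover_number_complete; move: large; rewrite -dE; lia.
split; first exact: ebounded_range b1 fE.
exists (clique_cover_number e); split.
  exact: borsuk_number_clique_cover b1 fE ncomp.
by move: large; rewrite -dE; lia.
Qed.
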